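(* Let $F_1,F_2$ be storage fee functions such that $\operatorname{dom}(F_1)\subset\operatorname{dom}(F_2)$ and $F_1=F_2$ on $\operatorname{dom}(F_1)$. Assume furthermore that $F_2$ is uniformly continuous on its domain with modulus of continuity $\omega$. Let $\lambda_1,\lambda_2$ be the minimizers of the problems associated to $F_1,F_2$ respectively. Then $$\|\lambda_1-\lambda_2\|^2\le8C_LN\Big(2\|c\|_\infty\sqrt N\,d_{\mathcal H}(\operatorname{dom}(F_2),\operatorname{dom}(F_1))+\omega\big(d_{\mathcal H}(\operatorname{dom}(F_2),\operatorname{dom}(F_1))\big)\Big).$$
   Context: Setting. $N\ge1$, $n\ge2$ are integers, $X\subset\mathbb{R}^n$ is compact, $Y=\{y_1,\dots,y_N\}\subset\mathbb{R}^n$ consists of $N$ distinct points, $c:X\times Y\to\mathbb{R}$, $\|c\|_\infty=\sup_{X\times Y}|c|$. $\mu$ is a Borel probability measure supported in $X$, absolutely continuous with respect to Lebesgue measure, with density $\rho$ that is $\alpha$-Hölder continuous, $\alpha\in(0,1]$. The cost satisfies: (Reg) $c(\cdot,y_i)\in C^2(X)$ for all $i$; (Twist) $\nabla_x c(x,y_i)\ne\nabla_x c(x,y_k)$ for all $x\in X$, $i\ne k$; (QC) for each $i$ there are a convex set $Y_i\subset\mathbb{R}^n$ and a $C^2$ diffeomorphism $\exp_i:Y_i\to X$ such that for all $t\in\mathbb{R}$ and $1\le k,i\le N$ the set $\{p\in Y_i: -c(\exp_i(p),y_k)+c(\exp_i(p),y_i)\le t\}$ is convex. $X$ is $c$-convex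 with respect to $Y$: $\exp_i^{-1}(X)$ is convex for every $i$. $\Lambda=\{\lambda\in\mathbb{R}^N:\sum_i\lambda^i=1,\ \lambda^i\ge0\}$; $\|\cdot\|$ is the Euclidean norm; $d_{\mathcal H}$ is the Hausdorff distance. A modulus of continuity is a nondecreasing function $\omega:[0,\infty)\to[0,\infty)$ with $\omega(s)\to\omega(0)=0$ as $s\to0$ and $|F_2(\lambda)-F_2(\lambda')|\le\omega(\|\lambda-\lambda'\|)$ on $\operatorname{dom}F_2$. A storage fee function is a proper closed convex function $F:\mathbb{R}^N\to\mathbb{R}\cup\{+\infty\}$ with effective domain $\operatorname{dom}F\subset\Lambda$. For $\lambda\in\Lambda$ let $\mathcal{C}(\lambda)=\min\{\int_Xc(x,S(x))\,d\mu: S:X\to Y\text{ measurable},\ S_\#\mu=\sum_i\lambda^i\delta_{y_i}\}$ ($+\infty$ off $\Lambda$), and $\mathcal{O}_F(\lambda)=\mathcal{C}(\lambda)+F(\lambda)$. The minimizer of the problem associated to $F$ is the minimizer $\lambda$ of $\mathcal{O}_F$. $C_L>0$ is a constant, depending only on $X,Y,c,\mu$, such that $\mathcal{C}$ is strongly convex on $\Lambda$ with constant $\frac1{4C_LN}$, i.e. $\mathcal{C}-\frac{1}{8C_LN}\|\cdot\|^2$ is convex on $\Lambda$ (such a constant is known to exist). *)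

(* Defs.v *)
From HB Require Import structures.
From mathcomp Require Import all_boot all_order all_algebra.
From mathcomp Require Import all_classical all_reals all_analysis.
From mathcomp Require Import measurable_realfun.
Set Implicit Arguments.
Unset Strict Implicit.
Unset Printing Implicit Defensive.
Import Order.TTheory GRing.Theory Num.Theory.
Import numFieldNormedType.Exports.
Local Open Scope classical_set_scope.
Local Open Scope ring_scope.

(* R^n with its Borel sigma-algebra; the carrier is convertible to 'rV[R]_n *)
Notation borelrV R n := (g_sigma_algebraType (@open 'rV[R]_n)).

Section rV_borel.
Context {R : realType}.

Lemma measurable_rV_coord n (i : 'I_n) :
  measurable_fun setT (fun x : borelrV R n => (x : 'rV[R]_n) 0 i).
Proof.
apply: (measurability _ (RGenOInfty.measurableE R)) => _ [_ [a ->] <-].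
rewrite setTI; apply: sub_sigma_algebra.
have /continuousP := @coord_continuous R 1 n 0 i.
by apply; rewrite set_itvoy; exact: open_gt.
Qed.

Lemma measurable_fun_rVP d (T : measurableType d) n (f : T -> borelrV R n) :
  (forall i, measurable_fun setT (fun x => (f x : 'rV[R]_n) 0 i)) ->
  measurable_fun setT f.
Proof.
move=> mf; apply: (@measurability _ _ _ (borelrV R n) _ _ open) => //.
move=> _ [U oU <-]; rewrite setTI.
pose B (qk : 'rV[rat]_n * nat) : set 'rV[R]_n :=
  [set x | forall j, `|ratr (qk.1 0 j) - x 0 j| < qk.2.+1%:R^-1].
pose G (m : nat) : set 'rV[R]_n :=
  if unpickle m is Some qk then (if `[< B qk `<=` U >] then B qk else set0)
  else set0.
have -> : U = \bigcup_m G m.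
  apply/seteqP; split => [x Ux|x [m _]]; last first.
    rewrite /G; case: unpickle => // qk; case: asboolP => // + ?; exact.
  have /nbhs_ballP[e /= e0 eU] : nbhs x U by exact: open_nbhs_nbhs.
  have [k ke] : exists k, k.+1%:R^-1 < e / 2.
    have e20 : 0 < e / 2 by rewrite divr_gt0.
    have [k _ /(_ k (leqnn _)) /= kP] := near_infty_natSinv_lt (PosNum e20).
    by exists k.
  have q j : {q : rat | `|ratr q - x 0 j| < k.+1%:R^-1}.
    apply: cid; have : x 0 j - k.+1%:R^-1 < x 0 j + k.+1%:R^-1.
      by rewrite ltrBlDr -addrA ltrDl addr_gt0 // invr_gt0 ltr0n.
    move=> /rat_in_itvoo[q]; rewrite in_itv/= => /andP[q1 q2].
    by exists q; rewrite ltr_distl q1 q2.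
  pose qk := (\row_j sval (q j), k) : 'rV[rat]_n * nat.
  exists (pickle qk) => //; rewrite /G pickleK.
  have Bx : B qk x by move=> j; rewrite /= mxE; exact: svalP (q j).
  case: asboolP => // -[] y By; apply: eU; split => // i j.
  rewrite ord1 /ball/=; have -> : x 0 j - y 0 j =
     - (ratr (qk.1 0 j) - x 0 j) + (ratr (qk.1 0 j) - y 0 j).
    by rewrite opprB addrA subrK.
  rewrite (le_lt_trans (ler_normD _ _))// normrN (splitr e) ltrD//.
    by rewrite (lt_trans (Bx j)).
  by rewrite (lt_trans (By j)).
rewrite preimage_bigcup; apply: bigcupT_measurable => m; rewrite /G.
case: unpickle => [qk|]; last by rewrite preimage_set0.
case: asboolP => _; last by rewrite preimage_set0.
rewrite (_ : f @^-1` B qk = \bigcap_(j in [set: 'I_n])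
   ((fun x => (f x : 'rV[R]_n) 0 j) @^-1`
     (ball (ratr (qk.1 0 j) : R) qk.2.+1%:R^-1))); last first.
  by apply/seteqP; split=> x /= Bx j => [_|]; exact: Bx.
apply: fin_bigcap_measurable => [|j _]; first exact: finite_finset.
rewrite -[X in measurable X]setTI.
by apply: mf => //; exact: measurable_ball.
Qed.


Definition rV_cons n (p : measurableTypeR R * borelrV R n) : borelrV R n.+1 :=
  \row_i (if unlift ord0 i is Some j then (p.2 : 'rV[R]_n) 0 j else p.1 : R).

Lemma measurable_rV_cons n : measurable_fun setT (@rV_cons n).
Proof.
apply: measurable_fun_rVP => i; rewrite /rV_cons.
under eq_fun do rewrite mxE.
case: unliftP => [j _|_]; last exact: measurable_fst.
exact: (measurableT_comp (measurable_rV_coord j) measurable_snd).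
Qed.

Section lebesgue_rVS.
Local Open Scope ereal_scope.
Variables (n : nat) (m : {sigma_finite_measure set (borelrV R n) -> \bar R}).

Definition lebesgue_rVS : set (borelrV R n.+1) -> \bar R :=
  pushforward (@lebesgue_measure R \x m) (@rV_cons n).

Let lebesgue_rVS0 : lebesgue_rVS set0 = 0.
Proof. by rewrite /lebesgue_rVS /pushforward preimage_set0 measure0. Qed.

Let lebesgue_rVS_ge0 A : 0 <= lebesgue_rVS A.
Proof. by rewrite /lebesgue_rVS /pushforward measure_ge0. Qed.

Let mpreimage_rV_cons (A : set (borelrV R n.+1)) :
  measurable A -> measurable (@rV_cons n @^-1` A).
Proof.
by move=> mA; rewrite -[X in measurable X]setTI; exact: measurable_rV_cons.
Qed.

Let lebesgue_rVS_sigma_additive : semi_sigma_additive lebesgue_rVS.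
Proof.
move=> F mF tF mUF; rewrite /lebesgue_rVS /pushforward preimage_bigcup.
apply: measure_semi_sigma_additive.
- by move=> k; exact: mpreimage_rV_cons.
- apply/trivIsetP => /= i j _ _ ij; rewrite -preimage_setI.
  by move/trivIsetP : tF => /(_ _ _ _ _ ij) ->//; rewrite preimage_set0.
- by rewrite -preimage_bigcup; exact: mpreimage_rV_cons.
Qed.

HB.instance Definition _ := isMeasure.Build _ _ _ lebesgue_rVS
  lebesgue_rVS0 lebesgue_rVS_ge0 lebesgue_rVS_sigma_additive.

Let lebesgue_rVS_sigma_finite : sigma_finite setT lebesgue_rVS.
Proof.
have /sigma_finiteP[F [FT ndF Foo]] := sigma_finiteT (@lebesgue_measure R).
have /sigma_finiteP[G [GT ndG Goo]] := sigma_finiteT m.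
pose u (x : borelrV R n.+1) : measurableTypeR R * borelrV R n :=
  ((x : 'rV[R]_n.+1) ord0 ord0, \row_j (x : 'rV[R]_n.+1) ord0 (lift ord0 j)).
have mu : measurable_fun setT u.
  apply/measurable_fun_pairP; split => /=.
    exact: (measurable_rV_coord ord0).
  apply: measurable_fun_rVP => j /=; under eq_fun do rewrite mxE.
  exact: (measurable_rV_coord (lift ord0 j)).
have uK p : u (rV_cons p) = p.
  case: p => a v; rewrite /u /rV_cons mxE unlift_none; congr pair.
  by apply/rowP => j; rewrite !mxE liftK.
exists (fun k => u @^-1` (F k `*` G k)).
  rewrite -preimage_bigcup (_ : \bigcup_k _ = setT) ?preimage_setT//.
  apply/seteqP; split=> // -[a v] _.
  have [i _ Fi] : (\bigcup_k F k) a by rewrite -FT.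
  have [j _ Gj] : (\bigcup_k G k) v by rewrite -GT.
  exists (maxn i j) => //; split.
    by move: a Fi; exact/subsetPset/ndF/leq_maxl.
  by move: v Gj; exact/subsetPset/ndG/leq_maxr.
move=> k; have [mF Fkoo] := Foo k; have [mG Gkoo] := Goo k; split.
  by rewrite -[X in measurable X]setTI; apply: mu => //; exact: measurableX.
rewrite /lebesgue_rVS /pushforward -comp_preimage.
rewrite (_ : u \o _ = id); last by apply/funext => p; exact: uK.
by rewrite preimage_id product_measure1E// lte_mul_pinfty// ge0_fin_numE.
Qed.

HB.instance Definition _ := Measure_isSigmaFinite.Build _ _ _ lebesgue_rVS
  lebesgue_rVS_sigma_finite.

End lebesgue_rVS.

(* n-dimensional Lebesgue measure (on the Borel sets) as the n-fold product of
   the one-dimensional one; lebesgue_rV_box computes it on product sets *)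
Fixpoint lebesgue_rV n : {sigma_finite_measure set (borelrV R n) -> \bar R} :=
  match n with
  | 0 => @dirac _ (borelrV R 0) (0 : 'rV[R]_0) R
  | m.+1 => lebesgue_rVS (lebesgue_rV m)
  end.

Lemma lebesgue_rV_box n (A : 'I_n -> set (measurableTypeR R)) :
  (forall i, measurable (A i)) ->
  lebesgue_rV n [set x : 'rV[R]_n | forall i, A i (x 0 i)] =
  (\prod_(i < n) lebesgue_measure (A i))%E.
Proof.
elim: n A => [|n IH] A mA.
  rewrite big_ord0 /= /dirac indicE mem_set// => i.
  by case: i.
rewrite big_ord_recl /= /lebesgue_rVS /pushforward.
have mB : measurable ([set x | forall i,
    A (lift ord0 i) ((x : 'rV[R]_n) 0 i)] : set (borelrV R n)).
  rewrite (_ : mkset _ = \bigcap_(i in [set: 'I_n])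
    ((fun x : borelrV R n => (x : 'rV[R]_n) 0 i) @^-1` A (lift ord0 i))).
    apply: fin_bigcap_measurable => [|j _]; first exact: finite_finset.
    rewrite -[X in measurable X]setTI.
    by apply: (measurable_rV_coord j); [exact: measurableT|exact: mA].
  by apply/seteqP; split=> x /= Bx j => [_|]; exact: Bx.
rewrite -IH// -product_measure1E//; congr (_ _).
apply/seteqP; split => -[a v] /=.
  move=> Av; split => /= [|i].
    by have := Av ord0; rewrite /rV_cons mxE unlift_none.
  by have := Av (lift ord0 i); rewrite /rV_cons mxE liftK.
move=> [Aa Av] i; rewrite /rV_cons mxE; by case: unliftP => [j ->|->].
Qed.
End rV_borel.

Section euclidean.
Context {R : realType}.

(* the norm `|x| of 'rV[R]_n provided by the library is the sup norm *)
Definition enorm n (x : 'rV[R]_n) : R := Num.sqrt (\sum_i x 0 i ^+ 2).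

Definition edist_set n (x : 'rV[R]_n) (A : set 'rV[R]_n) : R :=
  inf [set enorm (x - a) | a in A].

(* only meaningful when A and B are nonempty and bounded, since inf and sup
   are real-valued *)
Definition hausdorff_dist n (A B : set 'rV[R]_n) : R :=
  Num.max (sup [set edist_set a B | a in A]) (sup [set edist_set b A | b in B]).

Definition holder_on n (X : set 'rV[R]_n) (alpha : R) (rho : 'rV[R]_n -> R) :=
  exists K : R, forall x x', X x -> X x' ->
    `|rho x - rho x'| <= K * enorm (x - x') `^ alpha.

End euclidean.

Section differentiability.
Context {R : realType}.

Definition partial n (V : normedModType R) (j : 'I_n) (f : 'rV[R]_n -> V) :=
  'D_(delta_mx 0 j : 'rV[R]_n) f.

Definition grad n (f : 'rV[R]_n -> R) (x : 'rV[R]_n) : 'rV[R]_n :=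
  \row_j partial j f x.

Definition C2_open n (V : normedModType R) (U : set 'rV[R]_n)
    (f : 'rV[R]_n -> V) :=
  [/\ forall x, U x -> differentiable f x,
      forall i x, U x -> differentiable (partial i f) x &
      forall i j x, U x -> {for x, continuous (partial j (partial i f))}].

Definition C2_extension n (V : normedModType R) (A : set 'rV[R]_n)
    (f g : 'rV[R]_n -> V) :=
  (exists U, [/\ open U, A `<=` U & C2_open U g]) /\
  (forall x, A x -> g x = f x).

(* f restricted to the (not necessarily open) set A is of class C^2: it is the
   restriction of a C^2 function defined on an open neighbourhood of A *)
Definition C2_on n (V : normedModType R) (A : set 'rV[R]_n)
    (f : 'rV[R]_n -> V) :=
  exists g, C2_extension A f g.

Definition C2_diffeo n (A B : set 'rV[R]_n) (f : 'rV[R]_n -> 'rV[R]_n) :=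
  exists g : 'rV[R]_n -> 'rV[R]_n,
    [/\ C2_on A f, C2_on B g,
        forall p, A p -> B (f p) /\ g (f p) = p &
        forall x, B x -> A (g x) /\ f (g x) = x].

End differentiability.

(* Throughout, Y = {y_1, ..., y_N} is given by y : 'I_N -> R^n, and c : X x Y -> R
   by a function c on R^n x R^n whose values off X x Y are never used *)
Section cost_conditions.
Context {R : realType} (n N : nat).
Variables (X : set 'rV[R]_n) (y : 'I_N -> 'rV[R]_n).
Variable c : 'rV[R]_n -> 'rV[R]_n -> R.

Definition cost_sup_norm : R :=
  sup [set r | exists x i, X x /\ r = `|c x (y i)|].

Definition Reg := forall i, C2_on X (c^~ (y i)).

(* The gradient of c(., y_i) at a point of X is that of a C^2 extension. The
   choice of the extension is immaterial when X is the closure of its interior,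
   which is the case as soon as X has positive Lebesgue measure and is C^2
   diffeomorphic to a convex set. *)
Definition Twist := forall i k, i <> k -> forall gi gk,
  C2_extension X (c^~ (y i)) gi -> C2_extension X (c^~ (y k)) gk ->
  forall x, X x -> grad gi x <> grad gk x.

Variables (D : 'I_N -> set 'rV[R]_n) (cexp : 'I_N -> 'rV[R]_n -> 'rV[R]_n).

(* D i is the convex domain Y_i of the c-exponential map exp_i = cexp i *)
Definition QC := forall i,
  [/\ convex_set (D i), C2_diffeo (D i) X (cexp i) &
      forall (t : R) (k : 'I_N),
        convex_set [set p | D i p /\
          - c (cexp i p) (y k) + c (cexp i p) (y i) <= t]].

Definition c_convex := forall i, convex_set (D i `&` cexp i @^-1` X).

End cost_conditions.

Section extended_real_functions.
Context {R : realType} (N : nat).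
Implicit Types (f F : 'rV[R]_N -> \bar R) (A : set 'rV[R]_N).
Local Open Scope ereal_scope.

Definition simplex : set 'rV[R]_N :=
  [set l | (\sum_i l 0%R i = 1)%R /\ forall i, (0 <= l 0%R i)%R].

Definition edom F : set 'rV[R]_N := [set l | F l < +oo].

(* used only for functions that do not take the value -oo on A *)
Definition econvex_on A f := forall (t : R) l l', (0 <= t <= 1)%R ->
  A l -> A l' ->
  f (t *: l + (1 - t) *: l')%R <= t%:E * f l + (1 - t)%:E * f l'.

Definition strongly_convex_on A (kappa : R) f :=
  econvex_on A (fun l => f l - (kappa / 2 * enorm l ^+ 2)%:E).

Definition proper F := (forall l, F l != -oo) /\ edom F !=set0.

Definition storage_fee F :=
  [/\ proper F, lower_semicontinuous F, econvex_on setT F & edom F `<=` simplex].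

Definition modulus_of_continuity (omega : R -> R) F :=
  [/\ forall s, (0 <= s)%R -> (0 <= omega s)%R,
      forall s t, (0 <= s)%R -> (s <= t)%R -> (omega s <= omega t)%R,
      (omega 0 = 0)%R, omega s @[s --> 0^'+] --> (0%R : R) &
      forall l l', edom F l -> edom F l' ->
        `|F l - F l'| <= (omega (enorm (l - l')%R))%:E].

Definition minimizer f l := forall l', f l <= f l'.

End extended_real_functions.
Arguments simplex {R} N.

Section transport.
Context {R : realType} (n N : nat).
Variables (X : set (borelrV R n)) (y : 'I_N -> borelrV R n).
Variable c : 'rV[R]_n -> 'rV[R]_n -> R.
Variable mu : {measure set (borelrV R n) -> \bar R}.
Local Open Scope ereal_scope.

Definition supported_in := mu (~` X) = 0.

Definition density_on (rho : 'rV[R]_n -> R) :=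
  (forall x, X x -> (0 <= rho x)%R) /\
  forall A : set (borelrV R n), measurable A -> A `<=` X ->
    mu A = \int[lebesgue_rV n]_(x in A) (rho x)%:E.

(* S : X -> Y is measurable and S_# mu = sum_i l^i delta_{y_i} *)
Definition transport_map (l : 'rV[R]_N) (S : borelrV R n -> borelrV R n) :=
  [/\ measurable_fun X S, forall x, X x -> exists i, S x = y i &
      forall B, measurable B ->
        mu (X `&` S @^-1` B) = \sum_(i < N) (l 0%R i)%:E * \d_(y i) B].

Definition transport_cost (l : 'rV[R]_N) : \bar R :=
  if `[< simplex N l >] then
    ereal_inf [set \int[mu]_(x in X) (c x (S x))%:E | S in transport_map l]
  else +oo.

Definition storage_objective (F : 'rV[R]_N -> \bar R) (l : 'rV[R]_N) :=
  transport_cost l + F l.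

End transport.

(* Main.v *)
Require Import Defs.
From mathcomp Require Import all_boot all_order all_algebra.
From mathcomp Require Import all_classical all_reals all_analysis.
From mathcomp Require Import measurable_realfun ring lra.
Import Order.TTheory GRing.Theory Num.Theory.
Import numFieldNormedType.Exports.
Local Open Scope classical_set_scope.
Local Open Scope ring_scope.
Set Implicit Arguments.
Unset Strict Implicit.
Unset Printing Implicit Defensive.

(* Since mu has a density, every measurable set splits into pieces of arbitrary
   prescribed masses. Hence a transport map to l' can be turned into a transport
   map to l by relabelling a set of mass at most sum_i |l_i - l'_i|, so C is
   finite and Lipschitz on the simplex, with constant 2 |c|_oo sqrt N for the
   Euclidean norm. Strong convexity gives
     |l1 - l2|^2 / (8 C_L N) <= (C + F2)(l1) - (C + F2)(l2),
   and (C + F2)(l1) <= (C + F2)(l) for every l in dom F1. One would like to take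
   for l a point of dom F1 closest to l2. The domain need not be closed, so l is
   taken in its closure: lower semicontinuity and uniform continuity of F2 put it
   in dom F2, and the inequality persists by approximation. *)

(** * Splitting measurable sets into pieces of prescribed mass *)

Section labellings.
Context d (T : measurableType d) (R : realType).
Variable mu : {measure set T -> \bar R}.
Implicit Types (A B X : set T).
Local Open Scope ereal_scope.

Lemma measure_sum_label N X (s : T -> 'I_N) :
  (forall i, measurable (X `&` s @^-1` [set i])) ->
  mu X = \sum_(i < N) mu (X `&` s @^-1` [set i]).
Proof.
move=> ms.
rewrite {1}(_ : X = \bigcup_(i in [set: 'I_N]) (X `&` s @^-1` [set i])).
  rewrite measure_fin_bigcup; [|exact: finite_finset| |by []]; last first.
    by move=> i j _ _ [x [[_ /= <-] [_ /= <-]]].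
  symmetry; rewrite fsbig_seq ?index_enum_uniq//.
  rewrite (_ : [set` _] = setT)//.

  by apply/seteqP; split => i //= _; exact: mem_index_enum.
by apply/seteqP; split => [x Xx|x [i _ []//]]; exists (s x).
Qed.

Lemma measurable_label_eq N (X : set T) (s : T -> 'I_N) (B : 'I_N -> set T) :
  (forall i, measurable (X `&` s @^-1` [set i])) ->
  (forall i, measurable (X `&` B i)) ->
  measurable (X `&` [set x | B (s x) x]).
Proof.
move=> ms mB.
rewrite (_ : _ `&` _ = \bigcup_(i in [set: 'I_N])
    ((X `&` s @^-1` [set i]) `&` (X `&` B i))).
  apply: fin_bigcup_measurable => [|i _]; first exact: finite_finset.
  exact: measurableI.
apply/seteqP; split => [x [Xx Bx]|x [i _ [[Xx /= sx] [_ Bx]]]].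
  by exists (s x).
by split => //=; rewrite sx.
Qed.

Lemma measurable_fun_label d' (U : measurableType d') N (X : set T)
    (s : T -> 'I_N) (g : 'I_N -> T -> U) :
  (forall i, measurable (X `&` s @^-1` [set i])) ->
  (forall i, measurable_fun X (g i)) ->
  measurable_fun X (fun x => g (s x) x).
Proof.
move=> ms mg mX B mB.
by apply: (measurable_label_eq (B := fun i => g i @^-1` B)) => // i; exact: mg.
Qed.

(** The intermediate value property of an atomless measure, stated inside every measurable set so
    that the cutting can be iterated. *)
Definition divisible := forall A (w : R), measurable A -> (0 <= w)%R ->
  w%:E <= mu A -> exists B, [/\ measurable B, B `<=` A & mu B = w%:E].

Hypothesis mufin : mu setT < +oo.

Let mu_lty A : measurable A -> mu A < +oo.
Proof.
move=> mA; apply: le_lt_trans mufin.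
by apply: le_measure; rewrite ?inE//; exact: measurableT.
Qed.

Section level_sets.
Variables (f : T -> R) (A : set T) (w : R).
Hypotheses (mf : measurable_fun setT f) (mA : measurable A).

Let mL (s : R) : measurable (A `&` [set x | (f x <= s)%R]).
Proof.
apply: measurableI => //; rewrite -[X in measurable X]setTI.
rewrite (_ : [set _ | _] = f @^-1` `]-oo, s]%classic); first exact: mf.
by apply/seteqP; split => x /=; rewrite in_itv.
Qed.

Lemma measure_bigcup_sublevel_le (u : nat -> R) :
  {homo u : n m / (n <= m)%N >-> (n <= m)%R} ->
  (forall k, mu (A `&` [set x | (f x <= u k)%R]) <= w%:E) ->
  mu (A `&` [set x | exists k, (f x <= u k)%R]) <= w%:E.
Proof.
move=> ndu lew; rewrite (_ : _ `&` _ =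
  \bigcup_k (A `&` [set x | (f x <= u k)%R])); last first.
  by apply/seteqP; split => [x [Ax [k fx]]|x [k _ [Ax fx]]];
    [exists k|split => //; exists k].
have cv : mu (A `&` [set x | (f x <= u k)%R]) @[k --> \oo] -->
    mu (\bigcup_k (A `&` [set x | (f x <= u k)%R])).
  apply: nondecreasing_cvg_mu => //; first exact: bigcup_measurable.
  move=> n m nm; apply/subsetPset; apply: setIS => x /= fx.
  exact: le_trans fx (ndu _ _ nm).
have /cvg_lim <- // := cv.
apply: lime_le; last exact: nearW.
by apply/cvg_ex; exists (mu (\bigcup_k (A `&` [set x | (f x <= u k)%R]))).
Qed.

(** Continuity from above; here the finiteness of [mu] enters, through [mu_lty]. *)
Lemma measure_bigcap_sublevel_ge (u : nat -> R) :
  {homo u : n m / (n <= m)%N >-> (m <= n)%R} ->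
  (forall k, w%:E <= mu (A `&` [set x | (f x <= u k)%R])) ->
  w%:E <= mu (A `&` [set x | forall k, (f x <= u k)%R]).
Proof.
move=> ndu lew; rewrite (_ : _ `&` _ =
  \bigcap_k (A `&` [set x | (f x <= u k)%R])); last first.
  apply/seteqP; split => [x [Ax fx] k _|x fx]; first by split => //; exact: fx.
  by split => [|k]; [case: (fx 0%N I)|case: (fx k I)].
have cv : mu (A `&` [set x | (f x <= u k)%R]) @[k --> \oo] -->
    mu (\bigcap_k (A `&` [set x | (f x <= u k)%R])).
  apply: nonincreasing_cvg_mu => //.
  - exact: mu_lty.
  - exact: bigcap_measurable.
  move=> n m nm; apply/subsetPset; apply: setIS => x /= fx.
  exact: le_trans fx (ndu _ _ nm).
have /cvg_lim <- // := cv.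
apply: lime_ge; last exact: nearW.
by apply/cvg_ex; exists (mu (\bigcap_k (A `&` [set x | (f x <= u k)%R]))).
Qed.

End level_sets.

(** Null level sets make the distribution function of [f] on [A] continuous, so it takes the value
    [w]. At the supremum [s] of the levels of mass at most [w], the set where [f < s] has mass at
    most [w], the set where [f <= s] has mass at least [w], and they differ by a null set. *)
Lemma null_level_sets_divisible (f : T -> R) :
  measurable_fun setT f -> (forall s, mu (f @^-1` [set s]) = 0) -> divisible.
Proof.
move=> mf f0 A w mA w0 wA.
have mS (b : bool) (s : R) :
    measurable (A `&` [set x | (f x < s ?<= if b)%R]).
  apply: measurableI => //; rewrite -[X in measurable X]setTI.
  rewrite (_ : [set _ | _] = f @^-1` [set` Interval -oo%O (BSide (~~ b) s)]);
    first exact: mf.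
  by apply/seteqP; split => x; case: b; rewrite /= in_itv.
(* The extreme masses are set apart: for [w] equal to 0 the set [E] below may be empty, and for [w]
   equal to [mu A] it is unbounded. *)
have [->|wn0] := eqVneq w 0%R.
  by exists set0; split => //; rewrite measure0.
have {}w0 : (0 < w)%R by rewrite lt_neqAle eq_sym wn0.
have [wA'|wA'] := eqVneq w%:E (mu A); first by exists A; split.
have {}wA : w%:E < mu A by rewrite lt_neqAle wA' wA.
pose E := [set s | mu (A `&` [set x | (f x <= s)%R]) <= w%:E].
have le_mu (P Q : set T) : measurable (A `&` P) -> measurable (A `&` Q) ->
    P `<=` Q -> mu (A `&` P) <= mu (A `&` Q).
  by move=> mP mQ PQ; apply: le_measure; rewrite ?inE//; exact: setIS.
(* Otherwise all sublevels at [- k] have mass at least [w > 0], although their intersection is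
   empty. *)
have E0 : E !=set0.
  apply: contrapT => /set0P/negP; rewrite negbK => /eqP E0.
  have : w%:E <= mu (A `&` [set x | forall k, (f x <= - k%:R)%R]).
    apply: measure_bigcap_sublevel_ge => // [n m nm|k].
      by rewrite lerN2 ler_nat.
    apply: contrapT => /negP; rewrite -ltNge => /ltW kE.
    by have : E (- k%:R)%R by []; rewrite E0.
  rewrite (_ : _ `&` _ = set0) ?measure0 ?lee_fin ?leNgt ?w0//.
  apply/seteqP; split => // x [_ /= fx].
  have := archi_boundP (normr_ge0 (f x)); rewrite ltNge => /negP; apply.
  have := fx (Num.bound `|f x|).
  by rewrite lerNr => /le_trans; apply; rewrite -normrN ler_norm.
(* Otherwise all sublevels at [k] have mass at most [w], although they exhaust [A]. *)
have Eub : has_ubound E.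
  apply: contrapT => Eub.
  have : mu (A `&` [set x | exists k, (f x <= k%:R)%R]) <= w%:E.
    apply: measure_bigcup_sublevel_le => // [n m nm|k]; first by rewrite ler_nat.
    have [s Es ks] : exists2 s, E s & (k%:R <= s)%R.
      apply: contrapT => nE; apply: Eub; exists k%:R => s Es.
      by rewrite leNgt; apply/negP => ks; apply: nE; exists s => //; exact: ltW.
    apply: le_trans Es; apply: le_mu; [exact: (mS true)..|].
    by move=> x /= /le_trans; apply.
  rewrite (_ : _ `&` _ = A) ?leNgt ?wA//.
  apply/seteqP; split => [x []//|x Ax]; split => //.
  exists (Num.bound `|f x|).
  exact: le_trans (ler_norm _) (ltW (archi_boundP (normr_ge0 (f x)))).
set s := sup E.
(* The strict sublevel is the increasing union of the sublevels at [s - 1/(k+1)], each contained in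
   one whose level lies in [E]. Dually, in [gew], the levels [s + 1/(k+1)] lie outside [E]. *)
have ltw : mu (A `&` [set x | (f x < s)%R]) <= w%:E.
  rewrite (_ : [set _ | _] = [set x | exists k, (f x <= s - k.+1%:R^-1)%R]).
    apply: measure_bigcup_sublevel_le => // [n m nm|k].
      by rewrite lerB// lef_pV2 ?posrE ?ltr0n// ler_nat ltnS.
    have [t Et st] : exists2 t, E t & (s - k.+1%:R^-1 < t)%R.
      by apply: sup_adherent => //; rewrite invr_gt0.
    apply: le_trans Et; apply: le_mu; [exact: (mS true)..|].
    by move=> x /= /le_trans; apply; exact: ltW.
  apply/seteqP; split => [x /= fx|x [k /= fx]]; last first.
    by apply: le_lt_trans fx _; rewrite ltrBlDr ltrDl invr_gt0.
  have sf : (0 < s - f x)%R by rewrite subr_gt0.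
  have [k _ /(_ k (leqnn _)) /= kP] := near_infty_natSinv_lt (PosNum sf).
  by exists k; rewrite lerBrDl -lerBrDr; exact: ltW.
have gew : w%:E <= mu (A `&` [set x | (f x <= s)%R]).
  rewrite (_ : [set _ | _] = [set x | forall k, (f x <= s + k.+1%:R^-1)%R]).
    apply: measure_bigcap_sublevel_ge => // [n m nm|k].
      by rewrite lerD2l lef_pV2 ?posrE ?ltr0n// ler_nat ltnS.
    apply: contrapT => /negP; rewrite -ltNge => /ltW kE.
    have : (s + k.+1%:R^-1 <= s)%R by apply: ub_le_sup.
    by rewrite leNgt ltrDl invr_gt0 ltr0n.
  apply/seteqP; split => [x /= fx k|x /= fx].
    by apply: le_trans fx _; rewrite lerDl.
  rewrite leNgt; apply/negP => sf; have {}sf : (0 < f x - s)%R by rewrite subr_gt0.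
  have [k _ /(_ k (leqnn _)) /= kP] := near_infty_natSinv_lt (PosNum sf).
  by have := fx k; rewrite leNgt -ltrBrDl kP.
exists (A `&` [set x | (f x < s)%R]); split => //; first exact: (mS false).
apply/eqP; rewrite eq_le ltw/= (le_trans gew)//.
have mfs : measurable (f @^-1` [set s]).
  by rewrite -[X in measurable X]setTI; exact: mf.
rewrite -[leRHS]adde0 -(f0 s).
apply: le_trans (measureU2 _ _ _) => //; last exact: (mS false).
apply: le_measure; rewrite ?inE; first exact: (mS true).
  by apply: measurableU => //; exact: (mS false).
by move=> x [Ax /=]; rewrite le_eqVlt => /orP[/eqP|]; [right|left].
Qed.

Let mu_setD A B : measurable A -> measurable B ->
  mu (A `\` B) = mu A - mu (A `&` B).
Proof.
move=> mA mB; apply: measureD => //; exact: mu_lty.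
Qed.

Hypothesis hdiv : divisible.

(** By induction on the number of labels: cut off a piece of mass [w ord0] and label the rest with
    the remaining indices, shifted by [lift ord0]. *)
Lemma divisible_label N (w : 'I_N.+1 -> R) A : measurable A ->
  (forall i, 0 <= w i)%R -> mu A = (\sum_i w i)%:E ->
  exists s : T -> 'I_N.+1, forall i,
    measurable (A `&` s @^-1` [set i]) /\ mu (A `&` s @^-1` [set i]) = (w i)%:E.
Proof.
elim: N w A => [|N IH] w A mA w0 muA.
  exists (fun=> ord0) => i; rewrite (_ : _ `&` _ = A) ?ord1.
    by rewrite muA big_ord1.
  by apply/seteqP; split => [x []//|x Ax]; split => //=; rewrite ord1.
have [B [mB BA muB]] : exists B, [/\ measurable B, B `<=` A & mu B = (w ord0)%:E].
  apply: hdiv => //; rewrite muA lee_fin big_ord_recl lerDl.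
  exact: sumr_ge0.
have [|||s sP] := IH (fun i => w (lift ord0 i)) (A `\` B).
- exact: measurableD.
- by [].
- rewrite mu_setD//.
  rewrite (_ : A `&` B = B); last by apply/setIidPr.
  by rewrite muA muB big_ord_recl -EFinB addrAC subrr add0r.
exists (fun x => if x \in B then ord0 else lift ord0 (s x)) => i.
case: (unliftP ord0 i) => [j ->|->].
  rewrite (_ : A `&` _ = (A `\` B) `&` s @^-1` [set j]); first exact: sP.
  apply/seteqP; split => [x /= [Ax]|x /= [[Ax nBx] <-]].
    case: ifPn => // /negP; rewrite inE => nBx /lift_inj.
    by split.
  by split => //; rewrite memNset.
rewrite (_ : A `&` _ = B) ?muB//.
apply/seteqP; split => [x /= [Ax]|x /= Bx].
  by case: ifPn => //; rewrite inE.
by split; [exact: BA|rewrite mem_set].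
Qed.

(** Each piece of [s'] is subdivided according to a row of a coupling of [l'] and [l]. Piece [i]
    keeps at least the mass [min (l i) (l' i)] under its old label, so at most [|l i - l' i|] of it
    is relabelled. *)
Lemma divisible_relabel N X (l l' : 'I_N.+1 -> R) (s' : T -> 'I_N.+1) :
  measurable X -> (forall i, 0 <= l i)%R -> (forall i, 0 <= l' i)%R ->
  (\sum_i l i = \sum_i l' i)%R ->
  (forall i, measurable (X `&` s' @^-1` [set i])) ->
  (forall i, mu (X `&` s' @^-1` [set i]) = (l' i)%:E) ->
  exists s : T -> 'I_N.+1, [/\
    forall i, measurable (X `&` s @^-1` [set i]),
    forall i, mu (X `&` s @^-1` [set i]) = (l i)%:E,
    measurable (X `&` [set x | s x <> s' x]) &
    mu (X `&` [set x | s x <> s' x]) <= (\sum_i `|l i - l' i|)%:E].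
Proof.
move=> mX l0 l'0 sl ms' mus'.
pose m i := Num.min (l i) (l' i).
have ml i : (m i <= l i)%R by rewrite ge_min lexx.
have ml' i : (m i <= l' i)%R by rewrite ge_min lexx orbT.
pose e : R := (\sum_i (l i - m i))%R.
have e0 : (0 <= e)%R by apply: sumr_ge0 => i _; rewrite subr_ge0.
have ee' : e = (\sum_i (l' i - m i))%R by rewrite /e !sumrB sl.
(* the coupling keeps as much mass as possible on the diagonal and distributes
   the excess independently *)
pose P i j : R :=
  ((i == j)%:R * m i + (l' i - m i) * (l j - m j) / e)%R.
have P0 i j : (0 <= P i j)%R.
  rewrite addr_ge0 ?mulr_ge0 ?invr_ge0 ?subr_ge0 ?ler0n//.
  by rewrite le_min l0 l'0.
have sum_delta i (g : 'I_N.+1 -> R) : (\sum_j (i == j)%:R * g j = g i)%R.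
  rewrite (bigD1 i)//= eqxx mul1r big1 ?addr0// => j ji.
  by rewrite eq_sym (negbTE ji) mul0r.
have dm i j : ((i == j)%:R * m i = (i == j)%:R * m j)%R.
  by case: eqP => [->|_]//; rewrite !mul0r.
have Pl' i : (\sum_j P i j = l' i)%R.
  rewrite big_split/=.
  under eq_bigr do rewrite dm.
  (* When [e = 0] the quotient is 0 by the convention on division, and each nonnegative term of the
     sum [e] vanishes, so [l' i = m i] and the diagonal alone has the right marginal. The other
     marginal is treated in the same way. *)
  rewrite sum_delta -mulr_suml -mulr_sumr -/e; have [e_eq0|en0] := eqVneq e 0%R.
    rewrite e_eq0 mulr0 mul0r addr0; apply/eqP; rewrite eq_sym -subr_eq0.
    move/eqP: e_eq0; rewrite ee' psumr_eq0 => [|j _]; last by rewrite subr_ge0.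
    by move/allP => /(_ i (mem_index_enum _))/=.
  by rewrite mulfK// addrC subrK.
have Pl j : (\sum_i P i j = l j)%R.
  rewrite big_split/=.
  under eq_bigr => i _ do rewrite eq_sym.
  rewrite sum_delta -!mulr_suml -ee'; have [e_eq0|en0] := eqVneq e 0%R.
    rewrite e_eq0 mul0r mul0r addr0; apply/eqP; rewrite eq_sym -subr_eq0.
    move/eqP: e_eq0; rewrite /e psumr_eq0 => [|i _]; last by rewrite subr_ge0.
    by move/allP => /(_ j (mem_index_enum _))/=.
  by rewrite mulrAC mulfV// mul1r addrC subrK.
have /choice[S SP] i : exists s : T -> 'I_N.+1, forall j,
    measurable (X `&` s' @^-1` [set i] `&` s @^-1` [set j]) /\
    mu (X `&` s' @^-1` [set i] `&` s @^-1` [set j]) = (P i j)%:E.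
  by apply: divisible_label => //; rewrite mus' Pl'.
pose s x := S (s' x) x.
have sI i j : (X `&` s @^-1` [set j]) `&` s' @^-1` [set i] =
    X `&` s' @^-1` [set i] `&` S i @^-1` [set j].
  rewrite setIAC; apply/seteqP.
  by split => x [[Xx /= s'x]]; rewrite /s s'x.
have ms j : measurable (X `&` s @^-1` [set j]).
  rewrite (_ : _ `&` _ = \bigcup_(i in [set: 'I_N.+1])
      ((X `&` s @^-1` [set j]) `&` s' @^-1` [set i])).
    apply: fin_bigcup_measurable => [|i _]; first exact: finite_finset.
    by rewrite sI; case: (SP i j).
  by apply/seteqP; split => [x Xx|x [i _ []//]]; exists (s' x).
have md : measurable (X `&` [set x | s x <> s' x]).
  apply: (measurable_label_eq (B := fun i => [set x | i <> s' x]) ms) => i.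
  rewrite (_ : _ `&` _ = X `\` (X `&` s' @^-1` [set i])).
    exact: measurableD.
  apply/seteqP; split => x [Xx /= h]; split => //.
    by move=> [_ xi]; apply: h.
  by move=> xi; apply: h.
exists s; split => //.
  move=> j; rewrite (@measure_sum_label _ _ s').
    by under eq_bigr => i _ do rewrite sI (SP i j).2; rewrite sumEFin Pl.
  by move=> i; rewrite sI; case: (SP i j).
rewrite (@measure_sum_label _ _ s') => [|i].
  rewrite -sumEFin; apply: lee_sum => i _.
  rewrite (_ : _ `&` _ = (X `&` s' @^-1` [set i]) `\`
     (X `&` s' @^-1` [set i] `&` S i @^-1` [set i])).
    rewrite mu_setD//.
      rewrite setIA setIid mus' (SP i i).2 -EFinB lee_fin /P eqxx mul1r opprD addrA.
      rewrite lerBlDr (@le_trans _ _ `|l i - l' i|%R)//; last first.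
        by rewrite lerDl !mulr_ge0 ?invr_ge0 ?subr_ge0.
      rewrite /m minEle; case: ifPn => _; last by rewrite subrr.
      by rewrite distrC ler_norm.
    by case: (SP i i).
  apply/seteqP; split => x; rewrite /s /=.
    by move=> [[Xx ss'] s'x]; split => // -[_ sx]; apply: ss'; rewrite s'x.
  move=> [[Xx s'x] h]; split => //; split => // ss'.
  by apply: h; split => //; rewrite -{2}s'x -ss' s'x.
rewrite (_ : _ `&` _ = (X `&` [set x | s x <> s' x]) `&`
    (X `&` s' @^-1` [set i])); first exact: measurableI.
by rewrite setIACA setIid setIA.
Qed.

End labellings.

(** * Transport maps as labellings; finiteness and Lipschitz bound of the transport cost *)

Lemma closed_measurable_borelrV (R : realType) n (A : set (borelrV R n)) :
  closed (A : set 'rV[R]_n) -> measurable A.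
Proof.
move=> cA; rewrite -[X in measurable X]setCK; apply: measurableC.
by apply: sub_sigma_algebra; exact: closed_openC.
Qed.

Section transport_cost_lipschitz.
Context (R : realType) (n N : nat).
Variables (X : set (borelrV R n)) (y : 'I_N.+1 -> borelrV R n).
Variables (c : 'rV[R]_n -> 'rV[R]_n -> R) (mu : {measure set (borelrV R n) -> \bar R}).
Variable M : R.
Hypotheses (mX : measurable X) (mufin : (mu setT < +oo)%E)
  (muX : (mu X = 1)%E) (y_inj : injective y).
Hypothesis mc : forall i, measurable_fun X (fun x => c x (y i)).
Hypothesis cM : forall x i, X x -> `|c x (y i)| <= M.
Hypothesis hdiv : divisible mu.
Implicit Types (l : 'rV[R]_N.+1) (s : borelrV R n -> 'I_N.+1).

Let M_ge0 : 0 <= M.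
Proof.
have /set0P[x Xx] : X != set0.
  apply/eqP => X0; move: muX; rewrite X0 measure0 => /eqP.
  by rewrite eqe eq_sym oner_eq0.
exact: le_trans (cM ord0 Xx).
Qed.

(** A transport map read on indices: [S x = y (s x)]. The push-forward condition then reduces to the
    masses of finitely many pieces. *)
Definition labels l s := forall i, measurable (X `&` s @^-1` [set i]) /\
  mu (X `&` s @^-1` [set i]) = (l 0 i)%:E.

Definition label_cost s : \bar R := (\int[mu]_(x in X) (c x (y (s x)))%:E)%E.

Let measurable_set1_borelrV (v : borelrV R n) : measurable [set v].
Proof.
apply: closed_measurable_borelrV.
exact/accessible_closed_set1/hausdorff_accessible/norm_hausdorff.
Qed.

Lemma transport_map_labels l S : transport_map X y mu l S ->
  exists2 s, labels l s & forall x, X x -> S x = y (s x).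
Proof.
move=> [mS Sy muS].
have /choice[s sP] x : exists i, X x -> S x = y i.
  have [/Sy[i Si]|nX] := pselect (X x); first by exists i.
  by exists ord0.
exists s => // i.
have -> : X `&` s @^-1` [set i] = X `&` S @^-1` [set y i].
  apply/seteqP; split => x [Xx /=]; first by move=> <-; split; [|exact: sP].
  by rewrite sP// => /y_inj si; split.
split; first exact: mS mX _ (measurable_set1_borelrV _).
rewrite muS; last exact: measurable_set1_borelrV.
rewrite (bigD1 i)//= diracE mem_set// mule1 big1 ?adde0// => j ji.
by rewrite diracE memNset ?mule0//= => /y_inj /eqP; rewrite (negbTE ji).
Qed.

Lemma labels_transport_map l s : labels l s ->
  transport_map X y mu l (fun x => y (s x)).
Proof.
move=> ls.
have mS : measurable_fun X (fun x => y (s x)).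
  apply: (measurable_fun_label (g := fun i => cst (y i))) => i.
    exact: (ls i).1.
  exact: measurable_cst.
split=> [//|x _|B mB]; first by exists (s x).
rewrite (@measure_sum_label _ _ _ mu _ _ s) => [|i].
  apply: eq_bigr => i _; rewrite diracE; have [yB|yB] := boolP (y i \in B).
    rewrite mule1 -(ls i).2; congr (mu _); apply/seteqP.
    split => x /= [].
      by move=> [].
    by move=> Xx sx; rewrite sx; split => //; split => //; exact: set_mem.
  rewrite mule0 (_ : _ `&` _ = set0) ?measure0//.
  apply/seteqP; split => // x /= [[_ +] si]; rewrite si => yiB.
  by move: yB; rewrite mem_set.
rewrite (_ : _ `&` _ `&` _ = (X `&` (fun x => y (s x)) @^-1` B) `&`
  (X `&` s @^-1` [set i])); last by rewrite setIACA setIid setIA.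
by apply: measurableI; [exact: mS|exact: (ls i).1].
Qed.

Lemma integrable_label_cost s :
  (forall i, measurable (X `&` s @^-1` [set i])) ->
  mu.-integrable X (fun x => (c x (y (s x)))%:E).
Proof.
move=> ms; apply: measurable_bounded_integrable => //.
- by rewrite muX ltry.
- exact: (@measurable_fun_label _ _ _ _ _ X s (fun i x => c x (y i)) ms mc).
exists M; split; first exact: num_real.
move=> K MK x /= Xx.
by apply: le_trans (cM _ Xx) _; exact: ltW.
Qed.

Lemma label_cost_bound s : (forall i, measurable (X `&` s @^-1` [set i])) ->
  (`|label_cost s| <= M%:E)%E.
Proof.
move=> ms; have mi := measurable_int mu (integrable_label_cost ms).
apply: le_trans (le_abse_integral _ _ _) _ => //.
apply: le_trans (integral_le_bound M%:E _ _ _ _) _ => //.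
- by apply: aeW => x Xx; rewrite lee_fin cM.
by rewrite muX mule1.
Qed.

(** The integrands agree where the labels do, and elsewhere differ by at most [2 * M]; the mass of
    the disagreement set is written as the integral of its indicator and the pointwise bound is
    integrated. *)
Lemma label_cost_le s s' :
  (forall i, measurable (X `&` s @^-1` [set i])) ->
  (forall i, measurable (X `&` s' @^-1` [set i])) ->
  measurable (X `&` [set x | s x <> s' x]) ->
  (label_cost s <=
   label_cost s' + (2 * M)%:E * mu (X `&` [set x | s x <> s' x]))%E.
Proof.
move=> ms ms' md.
pose D := X `&` [set x | s x <> s' x].
have iD : mu.-integrable X (fun x => (\1_D x)%:E).
  apply: measurable_bounded_integrable => //.
    by rewrite muX ltry.
  exists 1; split; first exact: num_real.
  move=> K K1 x /= _; rewrite indicE; case: (x \in D); rewrite ?normr1 ?normr0.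
    exact: ltW.
  exact: le_trans (ltW K1).
have -> : mu (X `&` [set x | s x <> s' x]) = (\int[mu]_(x in X) (\1_D x)%:E)%E.
  by rewrite integral_indic// -/D; congr (mu _); rewrite /D setIAC setIid.
rewrite -integralZl// -integralD//; last 2 first.
- exact: integrable_label_cost.
- exact: integrableZl.
apply: le_integral => //.
- exact: integrable_label_cost.
- by apply: integrableD => //; [exact: integrable_label_cost|exact: integrableZl].
move=> x /set_mem Xx; rewrite -EFinM -EFinD lee_fin indicE.
have [xD|xD] := boolP (x \in D).
  rewrite mulr1 -lerBlDl (le_trans (ler_norm _))//.
  by rewrite (le_trans (ler_normB _ _))// mulr_natl mulr2n lerD// cM.
suff -> : s x = s' x by rewrite mulr0 addr0.
by apply: contrapT => h; move: xD; rewrite mem_set.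
Qed.

Lemma labels_exist l : simplex N.+1 l -> exists s, labels l s.
Proof.
move=> [l1 l0].
by apply: (divisible_label mufin hdiv mX l0); rewrite l1 muX.
Qed.

Lemma transport_costE l : simplex N.+1 l ->
  transport_cost X y c mu l = ereal_inf [set label_cost s | s in labels l].
Proof.
move=> sl; rewrite /transport_cost asboolT//; congr ereal_inf.
apply/seteqP; split => [_ [S tS <-]|_ [s ls <-]].
  have [s ls Ss] := transport_map_labels tS.
  by exists s => //; apply: eq_integral => x /set_mem Xx; rewrite Ss.
by exists (fun x => y (s x)) => //; exact: labels_transport_map.
Qed.

(** All labelling costs lie between [- M] and [M], and divisibility provides at least one labelling,
    so the infimum is not over the empty set. *)
Lemma transport_cost_fin_num l : simplex N.+1 l ->
  transport_cost X y c mu l \is a fin_num.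
Proof.
move=> sl; rewrite transport_costE// fin_numElt; apply/andP; split.
  apply: (@lt_le_trans _ _ (- M%:E)%E); first exact: ltNyr.
  apply/ereal_infP => _ [s ls <-].
  rewrite leeNl (le_trans (lee_abs _))// abseN.
  exact: label_cost_bound (fun i => (ls i).1).
have [s ls] := labels_exist sl.
apply: (@le_lt_trans _ _ M%:E); last exact: ltry.
apply: ge_ereal_inf; exists (label_cost s); first by exists s.
exact: le_trans (lee_abs _) (label_cost_bound (fun i => (ls i).1)).
Qed.

Lemma transport_cost_lipschitz l l' : simplex N.+1 l -> simplex N.+1 l' ->
  (transport_cost X y c mu l <=
   transport_cost X y c mu l' + (2 * M * \sum_i `|l 0 i - l' 0 i|)%:E)%E.
Proof.
move=> sl sl'; rewrite -leeBlDr// [leRHS]transport_costE//.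
apply/ereal_infP => _ [s' ls' <-]; rewrite leeBlDr//.
have [||||||s [ms mus md mule]] := @divisible_relabel _ _ _ mu mufin hdiv N X
    (fun i => l 0 i) (fun i => l' 0 i) s'.
- exact: mX.
- exact: sl.2.
- exact: sl'.2.
- by rewrite sl.1 sl'.1.
- by move=> i; case: (ls' i).
- by move=> i; case: (ls' i).
rewrite transport_costE//; apply: ge_ereal_inf; exists (label_cost s).
  by exists s => // i; split.
apply: le_trans (label_cost_le ms (fun i => (ls' i).1) md) _.
rewrite leeD2l// (EFinM (2 * M)) lee_wpmul2l// lee_fin mulr_ge0//.
Qed.

End transport_cost_lipschitz.

(** * Euclidean norm, and distances between subsets of the simplex *)

Section euclidean_norm.
Context (R : realType) (N : nat).
Implicit Types (x l : 'rV[R]_N) (A : set 'rV[R]_N).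

Lemma enorm_ge0 x : 0 <= enorm x.
Proof. exact: sqrtr_ge0. Qed.

Lemma sqr_enorm x : enorm x ^+ 2 = \sum_i x 0 i ^+ 2.
Proof. by rewrite sqr_sqrtr// sumr_ge0// => i _; exact: sqr_ge0. Qed.

Lemma enorm0 : enorm (0 : 'rV[R]_N) = 0.
Proof.
by rewrite /enorm big1 ?sqrtr0// => i _; rewrite mxE expr0n.
Qed.

Lemma enormBC x l : enorm (x - l) = enorm (l - x).
Proof.
by congr Num.sqrt; apply: eq_bigr => i _; rewrite !mxE -sqrrN opprB.
Qed.

Lemma continuous_enormB l : continuous (fun x => enorm (l - x)).
Proof.
have ci i : continuous (fun x => (l - x) 0 i ^+ 2).
  rewrite (_ : (fun x => _) =
      (fun x : 'rV[R]_N => (l 0 i - x 0 i) * (l 0 i - x 0 i))); last first.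
    by apply/funext => x; rewrite !mxE expr2.
  have cx (x : 'rV[R]_N) : l 0 i - z 0 i @[z --> x] --> l 0 i - x 0 i.
    exact: (cvgB (cvg_cst (l 0 i)) (@coord_continuous R 1 N 0 i x)).
  by move=> x; exact: (cvgM (cx x) (cx x)).
move=> x; apply: (@continuous_comp _ _ _ (fun x => \sum_i (l - x) 0 i ^+ 2) Num.sqrt);
  last exact: sqrt_continuous.
by move: x; apply: continuous_big => [|i _]; [exact: add_continuous|exact: ci].
Qed.

(** Cauchy-Schwarz against the constant vector 1: expand the square of the sum and bound each
    product [a * b] by [a^2 / 2 + b^2 / 2]. *)
Lemma sum_norm_le_enorm x : \sum_i `|x 0 i| <= Num.sqrt N%:R * enorm x.
Proof.
rewrite -ler_sqr ?nnegrE ?mulr_ge0 ?sqrtr_ge0 ?enorm_ge0 ?sumr_ge0//.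
rewrite exprMn sqr_enorm sqr_sqrtr ?ler0n// expr2 mulr_suml.
under eq_bigr do rewrite mulr_sumr.
apply: (@le_trans _ _ (\sum_i \sum_j (x 0 i ^+ 2 / 2 + x 0 j ^+ 2 / 2))).
  apply: ler_sum => i _; apply: ler_sum => j _.
  rewrite -(real_normK (num_real (x 0 i))) -(real_normK (num_real (x 0 j))).
  have := sqr_ge0 (`|x 0 i| - `|x 0 j|); nra.
under eq_bigr do rewrite big_split/= sumr_const card_ord -mulr_suml.
rewrite big_split/= sumr_const card_ord sumrMnl -mulr_suml.
by rewrite -mulrnDl -splitr mulr_natl.
Qed.

(** The defect term [t * (1 - t)] is what strong convexity gains over convexity along a segment. *)
Lemma sqr_enorm_convex (t : R) x l :
  enorm (t *: x + (1 - t) *: l) ^+ 2 =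
  t * enorm x ^+ 2 + (1 - t) * enorm l ^+ 2 - t * (1 - t) * enorm (x - l) ^+ 2.
Proof.
rewrite !sqr_enorm !mulr_sumr -big_split/= -sumrB.
by apply: eq_bigr => i _; rewrite !mxE; ring.
Qed.

Lemma simplex_coord_itv l i : simplex N l -> 0 <= l 0 i <= 1.
Proof.
move=> [<- l0]; rewrite l0/= (bigD1 i)//= lerDl.
exact: sumr_ge0.
Qed.

Lemma enormB_simplex_le x l : simplex N x -> simplex N l ->
  enorm (x - l) <= Num.sqrt N%:R.
Proof.
move=> sx sl; apply: ler_wsqrtr.
apply: (@le_trans _ _ (\sum_(i < N) 1)); last by rewrite sumr_const card_ord.
apply: ler_sum => i _; rewrite !mxE.
have := simplex_coord_itv i sx; have := simplex_coord_itv i sl; nra.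
Qed.

Lemma edist_set_le x A l : A l -> edist_set x A <= enorm (x - l).
Proof.
move=> Al; apply: ge_inf; last by exists l.
by exists 0 => _ [a _ <-]; exact: enorm_ge0.
Qed.

(** Inclusion in the simplex bounds the distances, so the real-valued [sup] in [hausdorff_dist] is a
    genuine upper bound. *)
Lemma edist_set_le_hausdorff (A B : set 'rV[R]_N) x :
  A `<=` simplex N -> B `<=` simplex N -> B !=set0 -> A x ->
  edist_set x B <= hausdorff_dist A B.
Proof.
move=> sA sB [b Bb] Ax; rewrite le_max; apply/orP; left.
apply: ub_le_sup; last by exists x.
exists (Num.sqrt N%:R) => _ [a Aa <-].
by apply: le_trans (edist_set_le _ Bb) (enormB_simplex_le _ _); [exact: sA|exact: sB].
Qed.

(** The closure of [A] is a closed subset of the unit cube, hence compact, and the continuous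
    distance to [x] attains its minimum there. *)
Lemma closure_closest A x : A `<=` simplex N -> A !=set0 ->
  exists2 l, closure A l & enorm (x - l) <= edist_set x A.
Proof.
move=> sA [a Aa].
have cK := @rV_compact R N (fun=> `[0, 1]%classic)
  (fun=> @segment_compact R 0 1).
have cA : compact (closure A).
  apply: (subclosed_compact _ cK); first exact: closed_closure.
  have /closure_id -> := compact_closed (@norm_hausdorff _ _) cK.
  apply: closure_subset => v Av i /=; rewrite in_itv/=.
  exact: simplex_coord_itv (sA _ Av).
have cA0 : closure A !=set0 by exists a; exact: subset_closure.
have [l /set_mem Al lmin] := EVT_min_rV cA0 cA
  (continuous_subspaceT (@continuous_enormB x)).
exists l => //; apply: lb_le_inf; first by exists (enorm (x - a)), a.
by move=> _ [b Ab <-]; apply: lmin; rewrite inE; exact: subset_closure.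
Qed.

End euclidean_norm.

(** * Stability of minimizers for an abstract strongly convex Lipschitz cost *)

Section minimizer_stability.
Context (R : realType) (N : nat).
Variables (C F1 F2 : 'rV[R]_N -> \bar R) (kappa L : R) (omega : R -> R).
Variables l1 l2 : 'rV[R]_N.
Hypotheses (kappa0 : 0 < kappa) (L0 : 0 <= L).
Hypothesis C_fin : forall l, simplex N l -> C l \is a fin_num.
Hypothesis C_Ny : forall l, C l != -oo%E.
Hypothesis C_lip : forall l l', simplex N l -> simplex N l' ->
  (C l <= C l' + (L * enorm (l - l'))%:E)%E.
Hypothesis C_conv : strongly_convex_on (simplex N) kappa C.
Hypotheses (hF1 : storage_fee F1) (hF2 : storage_fee F2).
Hypothesis dom12 : edom F1 `<=` edom F2.
Hypothesis F12 : forall l, edom F1 l -> F1 l = F2 l.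
Hypothesis homega : modulus_of_continuity omega F2.
Hypothesis hl1 : minimizer (fun l => C l + F1 l)%E l1.
Hypothesis hl2 : minimizer (fun l => C l + F2 l)%E l2.

(** The objective is finite somewhere on the domain of [F], and as [C] is never [-oo] it cannot
    compensate for [F l = +oo]. *)
Lemma minimizer_edom (F : 'rV[R]_N -> \bar R) l : storage_fee F ->
  minimizer (fun l => C l + F l)%E l -> edom F l.
Proof.
move=> [[FNy [l' Fl']] _ _ sF] /(_ l') le_l'.
have : (C l + F l < +oo)%E.
  apply: le_lt_trans le_l' _; apply: lte_add_pinfty => //.
  by rewrite ltey_eq C_fin//; exact: sF.
rewrite /edom/=; case: (F l) (FNy l) => [r||]//; rewrite ?ltry//.
by case: (C l) (C_Ny l).
Qed.

Let F2_fin l : edom F2 l -> F2 l \is a fin_num.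
Proof.
by move: hF2 => [[FNy _] _ _ _] Fl; rewrite fin_numE FNy/= -ltey.
Qed.

Let sF2 : edom F2 `<=` simplex N. Proof. by case: hF2. Qed.
Let sF1 : edom F1 `<=` simplex N. Proof. by move=> l /dom12 /sF2. Qed.
Let El1 : edom F1 l1. Proof. exact: minimizer_edom hF1 hl1. Qed.
Let El2 : edom F2 l2. Proof. exact: minimizer_edom hF2 hl2. Qed.

(** Real-valued form of the objective for [F2]. Since [fine] sends infinite values to 0, it is
    meaningful on [edom F2] only. *)
Let O l : R := fine (C l) + fine (F2 l).

Let OE l : edom F2 l -> (O l)%:E = (C l + F2 l)%E.
Proof.
by move=> Fl; rewrite EFinD !fineK//; [exact: F2_fin|exact/C_fin/sF2].
Qed.

(** Minimality of [l2] is compared with strong convexity at [z = t l1 + (1 - t) l2]; dividing by [t]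
    and letting [t] tend to 0 removes the factor [1 - t]. *)
Lemma objective_gap : kappa / 2 * enorm (l1 - l2) ^+ 2 <= O l1 - O l2.
Proof.
set D := enorm (l1 - l2) ^+ 2.
have D0 : 0 <= kappa / 2 * D by rewrite mulr_ge0 ?sqr_ge0// divr_ge0// ltW.
have conv t : 0 <= t <= 1 ->
    t * (1 - t) * (kappa / 2 * D) <= t * (O l1 - O l2).
  move=> t01; have El1' := dom12 El1.
  have s1 := sF2 El1'; have s2 := sF2 El2.
  pose z := t *: l1 + (1 - t) *: l2.
  have : (F2 z <= t%:E * F2 l1 + (1 - t)%:E * F2 l2)%E.
    by case: hF2 => _ _ cF _; exact: cF.
  rewrite -(fineK (F2_fin El1')) -(fineK (F2_fin El2)) -!EFinM -EFinD => Fz.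
  have Ez : edom F2 z by apply: le_lt_trans Fz (ltry _).
  have sz := sF2 Ez.
  move: Fz; rewrite -(fineK (F2_fin Ez)) lee_fin => Fz.
  have := C_conv t01 s1 s2; rewrite -/z.
  rewrite -(fineK (C_fin s1)) -(fineK (C_fin s2)) -(fineK (C_fin sz)).
  rewrite -!EFinB -!EFinM -EFinD lee_fin sqr_enorm_convex -/D => Cz.
  have : O l2 <= O z by rewrite -lee_fin !OE//; exact: hl2.
  rewrite /O; move: Fz Cz.
  set a := fine (F2 z); set b := fine (F2 l1); set b' := fine (F2 l2).
  set u := fine (C z); set v := fine (C l1); set v' := fine (C l2).
  set p := enorm l1 ^+ 2; set q := enorm l2 ^+ 2.
  nra.
apply/ler_addgt0Pr => e e0.
pose K := kappa / 2 * D.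
(* Small enough for [t * K <= e]; the [+ 1] covers [K = 0]. *)
pose t := Num.min 1 (e / (K + 1)).
have K1 : 0 < K + 1 by rewrite ltr_pwDr.
have t0 : 0 < t by rewrite lt_min ltr01 divr_gt0.
have t1 : t <= 1 by rewrite ge_min lexx.
have tK : t * K <= e.
  apply: (@le_trans _ _ (e / (K + 1) * (K + 1))); last by rewrite mulfVK ?gt_eqF.
  apply: ler_pM => //; [exact: ltW| |by rewrite lerDl].
  by rewrite ge_min lexx orbT.
have : (1 - t) * K <= O l1 - O l2.
  by rewrite -(ler_pM2l t0) mulrA conv// (ltW t0).
rewrite -/K; lra.
Qed.

(** On [edom F1], [F2] is bounded by [F2 l2 + omega (sqrt N)], since the simplex has diameter at
    most [sqrt N]. If [F2 l] were [+oo], lower semicontinuity would make [F2] exceed this bound near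
    [l], hence at some point of [edom F1]. *)
Let closure_edom l : closure (edom F1) l -> edom F2 l.
Proof.
move=> cl; rewrite /edom /= ltNge leye_eq; apply/negP => /eqP Fl.
have [_ omega_mono _ _ omegaP] := homega.
have [_ lscF _ _] := hF2.
have [V Vl VF] := lscF l (fine (F2 l2) + omega (Num.sqrt N%:R))
  ltac:(by rewrite Fl ltry).
have [z [/= Ez Vz]] := cl _ Vl.
have := VF _ Vz; apply/negP; rewrite -leNgt.
have := omegaP _ _ (dom12 Ez) El2.
rewrite -(fineK (F2_fin (dom12 Ez))) -(fineK (F2_fin El2)) lee_fin => h.
rewrite lee_fin -lerBlDl (le_trans (ler_norm _))// (le_trans h)//.
apply: omega_mono; first exact: enorm_ge0.
by apply: enormB_simplex_le; [exact: sF1|exact: sF2].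
Qed.

Let O_le l l' : edom F2 l -> edom F2 l' ->
  O l <= O l' + L * enorm (l - l') + omega (enorm (l - l')).
Proof.
move=> El El'; have [_ _ _ _ /(_ _ _ El El')] := homega.
rewrite -(fineK (F2_fin El)) -(fineK (F2_fin El')) lee_fin => /(le_trans (ler_norm _)).
have := C_lip (sF2 El) (sF2 El').
rewrite -(fineK (C_fin (sF2 El))) -(fineK (C_fin (sF2 El'))) -EFinD lee_fin /O.
lra.
Qed.

Lemma minimizer_stability :
  kappa / 2 * enorm (l1 - l2) ^+ 2 <=
  L * hausdorff_dist (edom F2) (edom F1) +
  omega (hausdorff_dist (edom F2) (edom F1)).
Proof.
set d := hausdorff_dist _ _.
have [omega_ge0 omega_mono omega0 omega_cvg _] := homega.
have F1n0 : edom F1 !=set0 by exists l1.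
have [l cl l_le] := closure_closest l2 sF1 F1n0.
have El := closure_edom cl.
have l_d : enorm (l - l2) <= d.
  rewrite enormBC; apply: le_trans l_le _.
  exact: edist_set_le_hausdorff.
apply: le_trans objective_gap _; rewrite lerBlDr.
apply/ler_addgt0Pr => e e0.
have e20 : 0 < e / 2 by rewrite divr_gt0.
have [r [r0 omega_r]] := filter_ex (filterI (nbhs_right_gt 0)
  (cvgr_lt _ omega_cvg _ e20)).
(* A point [z] of [edom F1] within [r'] of [l] costs at most [e / 2] in the Lipschitz term and
   [e / 2] in the [omega] term. *)
pose r' := Num.min r (e / 2 / (L + 1)).
have L1 : 0 < L + 1 by rewrite ltr_pwDr.
have r'0 : 0 < r' by rewrite lt_min r0 divr_gt0.
have : nbhs l [set z | enorm (l - z) < r'].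
  apply: (cvgr_lt _ (@continuous_enormB _ _ l l)).
  by rewrite subrr enorm0.
move=> /cl [z [/= Ez zl]].
have Oz : O l1 <= O z.
  by rewrite -lee_fin !OE//; [rewrite -!F12//; exact: hl1|exact: dom12|exact: dom12].
have := O_le (dom12 Ez) El; have := O_le El El2.
have : L * enorm (z - l) <= e / 2.
  rewrite enormBC.
  apply: (@le_trans _ _ ((L + 1) * (e / 2 / (L + 1)))); last first.
    by rewrite mulrC mulfVK ?gt_eqF.
  apply: ler_pM => //; rewrite ?enorm_ge0 ?lerDl//.
  by apply: le_trans (ltW zl) _; rewrite ge_min lexx orbT.
have : omega (enorm (z - l)) <= e / 2.
  apply: le_trans (ltW omega_r); apply: omega_mono; first exact: enorm_ge0.
  by rewrite enormBC (le_trans (ltW zl))// ge_min lexx.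
have : omega (enorm (l - l2)) <= omega d by apply: omega_mono => //; exact: enorm_ge0.
have : L * enorm (l - l2) <= L * d by rewrite ler_wpM2l.
(* The chain is [O l1 <= O z <= O l + e <= O l2 + L * d + omega d + e]. *)
move: Oz; lra.
Qed.

End minimizer_stability.

(** * Consequences of the density of [mu] and of the regularity of the cost *)

Section transport_data.
Context (R : realType) (n N : nat).
Variables (X : set 'rV[R]_n) (y : 'I_N -> 'rV[R]_n).
Variable c : 'rV[R]_n -> 'rV[R]_n -> R.
Variable mu : {measure set (borelrV R n) -> \bar R}.

Lemma measurable_fun_within (A : set (borelrV R n)) (f : 'rV[R]_n -> R) :
  measurable A -> {within (A : set 'rV[R]_n), continuous f} ->
  measurable_fun A (f : borelrV R n -> R).
Proof.
move=> mA /continuousP cf.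
apply: (measurability _ (RGenOInfty.measurableE R)) => _ [_ [a ->] <-].
have /open_subspaceP[V oV VA] : open (f @^-1` `]a, +oo[ : set (subspace A)).
  by apply: cf; rewrite set_itvoy; exact: open_gt.
rewrite setIC -VA; apply: measurableI => //.
exact: sub_sigma_algebra.
Qed.

Lemma lebesgue_rV_hyperplane i (s : R) :
  lebesgue_rV n [set x : 'rV[R]_n | x 0 i = s] = 0%E.
Proof.
(* The hyperplane is a box with one factor reduced to a point; that factor has measure 0, and 0
   times [+oo] is 0. *)
pose A j : set (measurableTypeR R) := if j == i then [set s] else setT.
have mA j : measurable (A j).
  by rewrite /A; case: ifP => _; [exact: measurable_set1|exact: measurableT].
transitivity (lebesgue_rV n [set x : 'rV[R]_n | forall j, A j (x 0 j)]).
  congr (lebesgue_rV n _); apply/seteqP; rewrite /A.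
  split => [x /= xi j|x /(_ i)/=]; last by rewrite eqxx.
  by case: eqP => // ->.
rewrite lebesgue_rV_box// (bigD1 i)//= /A eqxx.
by rewrite [lebesgue_measure _]lebesgue_measure_set1 mul0e.
Qed.

Lemma density_null_hyperplane (rho : 'rV[R]_n -> R) i (s : R) :
  measurable (X : set (borelrV R n)) -> supported_in X mu ->
  density_on X mu rho -> mu [set x : 'rV[R]_n | x 0 i = s] = 0%E.
Proof.
move=> mX muX [_ rhoP]; set H := mkset _.
have mH : measurable (H : set (borelrV R n)).
  rewrite -[H]setTI.
  exact: (@measurable_rV_coord R n i measurableT _ (measurable_set1 s)).
have mHX : measurable (H `&` X : set (borelrV R n)) by exact: measurableI.
have muHX : mu (H `&` X) = 0%E.
  rewrite rhoP//.
  (* On a Lebesgue-null set, Lebesgue measure agrees with the zero measure on all measurable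
     subsets. *)
  rewrite (@eq_measure_integral _ _ _ _ mzero) ?integral_measure_zero// => A mA AH.
  apply/eqP; rewrite eq_le measure_ge0 andbT [leRHS]/= /mzero.
  rewrite -(lebesgue_rV_hyperplane i s).
  by apply: le_measure; rewrite ?inE// => x /AH [].
apply/eqP; rewrite eq_le measure_ge0 andbT.
apply: (@le_trans _ _ (mu (H `&` X) + mu (~` X))%E); last first.
  by rewrite muHX add0e muX.
apply: le_trans (measureU2 _ _ _) => //; last exact: measurableC.
apply: le_measure; rewrite ?inE//; first by apply: measurableU => //; exact: measurableC.
by move=> x Hx; have [Xx|nXx] := pselect (X x); [left|right].
Qed.

Lemma Reg_continuous i : Reg X y c -> {within X, continuous (c^~ (y i))}.
Proof.
move=> /(_ i)[g [[U [oU XU [gdiff _ _]]] gc]].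
apply: (@subspace_eq_continuous _ _ _ g) => [x /set_mem Xx|]; first exact: gc.
apply: continuous_in_subspaceT => x /set_mem /XU Ux.
exact/differentiable_continuous/gdiff.
Qed.

(** The real-valued [sup] dominates its set only when that set is bounded; compactness bounds each
    of the finitely many [c (., y j)], and the sum of these bounds serves for all. *)
Lemma cost_le_sup_norm x i : compact X -> Reg X y c -> X x ->
  `|c x (y i)| <= cost_sup_norm X y c.
Proof.
move=> cX hReg Xx; apply: ub_le_sup; last by exists x, i.
have /choice[K KP] j : exists K, forall z, X z -> `|c z (y j)| <= K.
  have [K [_ KP]] :=
    compact_bounded (continuous_compact (Reg_continuous (i := j) hReg) cX).
  exists (K + 1) => z Xz; apply: (KP (K + 1)); first by rewrite ltrDl.
  by exists z.
exists (\sum_j `|K j|) => _ [z [j [Xz ->]]].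
apply: le_trans (KP j z Xz) _; rewrite (bigD1 j)//=.
by rewrite (le_trans (ler_norm _))// lerDl sumr_ge0.
Qed.

End transport_data.

(** * Derivation of the estimate from the transport and stability bounds *)

Theorem proposition6p3 (R : realType) (n N : nat) (hn : (2 <= n)%N) (hN : (1 <= N)%N)
  (X : set 'rV[R]_n) (y : 'I_N -> 'rV[R]_n) (c : 'rV[R]_n -> 'rV[R]_n -> R)
  (mu : probability (borelrV R n) R) (rho : 'rV[R]_n -> R) (alpha : R)
  (D : 'I_N -> set 'rV[R]_n) (cexp : 'I_N -> 'rV[R]_n -> 'rV[R]_n)
  (CL : R) (F1 F2 : 'rV[R]_N -> \bar R) (omega : R -> R) (l1 l2 : 'rV[R]_N)
  (cX : compact X) (y_inj : injective y)
  (mu_supp : supported_in X mu) (mu_density : density_on X mu rho)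
  (halpha : 0 < alpha <= 1) (rho_holder : holder_on X alpha rho)
  (hReg : Reg X y c) (hTwist : Twist X y c)
  (hQC : QC X y c D cexp) (hX : c_convex X D cexp)
  (CL_gt0 : 0 < CL)
  (hCL : strongly_convex_on (simplex N) (4 * CL * N%:R)^-1 (transport_cost X y c mu))
  (hF1 : storage_fee F1) (hF2 : storage_fee F2)
  (dom12 : edom F1 `<=` edom F2)
  (F12 : forall l, edom F1 l -> F1 l = F2 l)
  (homega : modulus_of_continuity omega F2)
  (hl1 : minimizer (storage_objective X y c mu F1) l1)
  (hl2 : minimizer (storage_objective X y c mu F2) l2) :
  enorm (l1 - l2) ^+ 2 <=
    8 * CL * N%:R *
    (2 * cost_sup_norm X y c * Num.sqrt N%:R * hausdorff_dist (edom F2) (edom F1)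
     + omega (hausdorff_dist (edom F2) (edom F1))).
Proof.
case: N hN y y_inj hReg hTwist D cexp hQC hX F1 F2 l1 l2 hCL hF1 hF2 dom12 F12
  homega hl1 hl2 => // N _ y y_inj hReg _ D cexp _ _ F1 F2 l1 l2 hCL hF1 hF2
  dom12 F12 homega hl1 hl2.
have mX : measurable (X : set (borelrV R n)).
  exact: (closed_measurable_borelrV (compact_closed (@norm_hausdorff _ _) cX)).
have muX : mu X = 1%E.
  by rewrite -[X]setCK probability_setC ?[mu _]mu_supp ?sube0//; exact: measurableC.
have mufin : (mu setT < +oo)%E by rewrite probability_setT ltry.
have mc i : measurable_fun (X : set (borelrV R n)) (fun x => c x (y i)).
  exact: (measurable_fun_within mX (Reg_continuous hReg)).
have cM x i : X x -> `|c x (y i)| <= cost_sup_norm X y c.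
  exact: cost_le_sup_norm.
(* The first coordinate serves as the function whose level sets are null: these are hyperplanes. *)
have mudiv : divisible mu.
  apply: (@null_level_sets_divisible _ _ _ mu mufin
    (fun x : borelrV R n => (x : 'rV[R]_n) 0 (Ordinal (ltnW hn)))).
    exact: measurable_rV_coord.
  move=> s; exact: density_null_hyperplane mX mu_supp mu_density.
have M0 : 0 <= cost_sup_norm X y c.
  have [x Xx] : X !=set0.
    apply/set0P/eqP => X0; move: muX; rewrite X0 measure0 => /eqP.
    by rewrite eqe eq_sym oner_eq0.
  exact: le_trans (cM x ord0 Xx).
have kappa0 : 0 < (4 * CL * N.+1%:R)^-1 by rewrite invr_gt0 !mulr_gt0.
have C_fin l := transport_cost_fin_num (l := l) mX mufin muX y_inj mc cM mudiv.
have h := @minimizer_stability R N.+1 (transport_cost X y c mu) F1 F2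
  (4 * CL * N.+1%:R)^-1 (2 * cost_sup_norm X y c * Num.sqrt N.+1%:R) omega l1 l2
  kappa0 (mulr_ge0 (mulr_ge0 (ler0n _ 2) M0) (sqrtr_ge0 _)) C_fin _ _
  hCL hF1 hF2 dom12 F12 homega hl1 hl2.
(* Half the strong convexity constant is the inverse of the factor [8 * CL * N] in the
   conclusion. *)
have k2 : (4 * CL * N.+1%:R)^-1 / 2 = (8 * CL * N.+1%:R)^-1.
  by rewrite -invfM; congr (_^-1); ring.
rewrite -ler_pdivrMl ?mulr_gt0// -k2; apply: h => [l|l l' sl sl'].
  have [sl|nsl] := pselect (simplex N.+1 l).
    by have := C_fin _ sl; rewrite fin_numE => /andP[].
  by rewrite /transport_cost asboolF.
apply: le_trans (transport_cost_lipschitz mX mufin muX y_inj mc cM mudiv sl sl') _.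
rewrite leeD2l// lee_fin -!mulrA ler_wpM2l// ler_wpM2l//.
(* Passing from the sum of the coordinate differences to the Euclidean norm produces the factor
   [sqrt N]. *)
apply: le_trans (sum_norm_le_enorm (l - l')).
by apply: ler_sum => i _; rewrite !mxE.
Qed.
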